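(* Let $\{A_n\}_{n\in\mathbb N}$ be a sequence of nonnegative selfadjoint linear relations in a complex Hilbert space $\mathcal H$, let $A_\infty$ be a nonnegative selfadjoint linear relation in $\mathcal H$, and let $\mathcal L$ be a closed subspace of $\mathcal H$. If $\{A_n\}$ is non-increasing and converges to $A_\infty$ in the strong resolvent sense, then the sequence $\{(A_n)_{\mathcal L}\}$ is non-increasing and converges to $(A_\infty)_{\mathcal L}$ in the strong resolvent sense.
   Context: A linear relation (l.r.) in $\mathcal H$ is a closed linear subspace $A=\{\{f,f'\}\}$ of $\mathcal H\oplus\mathcal H$; $\operatorname{ran}A$ is the set of second components, $\operatorname{mul}A=\{f':\{0,f'\}\in A\}$; $A$ is selfadjoint if $A=A^*:=\{\{g,g'\}:(f',g)=(f,g')\ \forall\{f,f'\}\in A\}$, nonnegative if $(f',f)\ge0$ for all $\{f,f'\}\in A$. A nonnegative selfadjoint l.r. decomposes as $A=\mathrm{Graph}(A_o)\oplus(\{0\}\oplus\operatorname{mul}A)$ with $A_o$ a nonnegative selfadjoint operator in $\mathcal H\ominus\operatorname{mul}A$; its closed form is $A[\varphi]=\|A_o^{1/2}\varphi\|^2$, $\varphi\in\mathcal D[A]=\operatorname{dom}A_o^{1/2}$. The order $A_1\ge A_2$ means $\mathcal D[A_1]\subseteq\mathcal D[A_2]$ and $A_1[\varphi]\ge A_2[\varphi]$ for all $\varphi\in\mathcal D[A_1]$. For a closed subspace $\mathcal L$, $A_{\mathcal L}$ denotes the (existing, unique) maximal element of the set of nonnegative selfadjoint l.r. $\widetilde A$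 in $\mathcal H$ with $\widetilde A\le A$ and $\operatorname{ran}\widetilde A\subseteq\mathcal L$. $A_n\to A$ in the strong resolvent sense means that $(A_n+I)^{-1}\to(A+I)^{-1}$ strongly (these are bounded everywhere defined operators). *)

(* Defs.v *)
From HB Require Import structures.
From mathcomp Require Import all_boot all_order all_algebra.
From mathcomp Require Import sesquilinear.
From mathcomp Require Import all_classical all_reals all_analysis.
From mathcomp.real_closed Require Export complex.

Set Implicit Arguments.
Unset Strict Implicit.
Unset Printing Implicit Defensive.

Import Order.TTheory GRing.Theory Num.Theory Num.Def.
Import numFieldNormedType.Exports.

Local Open Scope classical_set_scope.
Local Open Scope ring_scope.
Local Open Scope complex_scope.

(* The inner product is linear in its first argument and conjugate-linear in
   the second one; it induces the given complete norm. *)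
HB.mixin Record CompleteNormedModule_isHilbert (R : realType) (H : Type)
    of CompleteNormedModule R[i] H := {
  inner : {dot H for conjC} ;
  innerxx : forall x : H, inner x x = `|x| ^+ 2
}.

#[short(type="hilbertType")]
HB.structure Definition Hilbert (R : realType) :=
  { H of CompleteNormedModule_isHilbert R H & CompleteNormedModule R[i] H }.

Definition closed_subspace (R : realType) (V : normedModType R[i])
    (M : set V) : Prop :=
  submod_closed (mem M) /\ closed M.

Section LinearRelations.
Context {R : realType} {H : hilbertType R}.
Implicit Types (A B S T : set (H * H)) (K L M : set H).

Definition ortho M : set H := [set x | forall y, M y -> inner x y = 0].

Definition ran A : set H := [set f' | exists f, A (f, f')].
Definition mul A : set H := [set f' | A (0, f')].

(* The value at x of the relation T, when T is the graph of an operator;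
   0 when x is not in the domain of T. *)
Definition value T (x : H) : H := xget 0 [set y | T (x, y)].

(* Relations are considered in a closed subspace K of H; the relations in H
   itself are obtained with K := setT. *)
Definition linear_relation K A : Prop :=
  closed_subspace A /\ A `<=` K `*` K.

Definition adjoint K A : set (H * H) :=
  [set g | (K `*` K) g /\
           forall f, A f -> inner f.2 g.1 = inner f.1 g.2].

Definition selfadjoint K A : Prop := A = adjoint K A.

Definition nonnegative A : Prop := forall f, A f -> 0 <= inner f.2 f.1.

Definition nonneg_selfadjoint K A : Prop :=
  [/\ linear_relation K A, selfadjoint K A & nonnegative A].

Definition operator_part A : set (H * H) :=
  A `&` (setT `*` ortho (mul A)).

Definition relation_square S : set (H * H) :=
  [set f | exists g, S (f.1, g) /\ S (g, f.2)].

(* S is the nonnegative selfadjoint square root of the operator part of A,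
   an operator in the orthogonal complement of mul A. *)
Definition is_sqrt A S : Prop :=
  [/\ nonneg_selfadjoint (ortho (mul A)) S, mul S = [set 0]
    & relation_square S = operator_part A].

Definition sqrt_op A : set (H * H) := xget set0 [set S | is_sqrt A S].

Definition form_dom A : set H := [set phi | exists g, sqrt_op A (phi, g)].
Definition form A (phi : H) : R[i] := `|value (sqrt_op A) phi| ^+ 2.

Definition lr_le A B : Prop :=
  form_dom B `<=` form_dom A /\
  forall phi, form_dom B phi -> form A phi <= form B phi.

Definition nonincreasing_lr (A : nat -> set (H * H)) : Prop :=
  forall m n, (m <= n)%N -> lr_le (A n) (A m).

Definition shorted_set A L : set (set (H * H)) :=
  [set B | [/\ nonneg_selfadjoint setT B, lr_le B A & ran B `<=` L]].

Definition maximal_lr (X : set (set (H * H))) : set (set (H * H)) :=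
  [set B | X B /\ forall C, X C -> lr_le B C -> C = B].

Definition shorted A L : set (H * H) :=
  xget set0 (maximal_lr (shorted_set A L)).

(* The graph of the inverse of A + I. *)
Definition resolvent A : set (H * H) :=
  [set h | exists f f', A (f, f') /\ h = (f' + f, f)].

Definition strong_resolvent_cvg (A : nat -> set (H * H)) B : Prop :=
  forall h, value (resolvent (A n)) h @[n --> \oo] --> value (resolvent B) h.

End LinearRelations.

(* Main.v *)
(* For a nonnegative selfadjoint relation A the resolvent P = (A + I)^-1 is a
   bounded operator with 0 <= P <= 1, A = {{Ph, h - Ph}}, and every such P
   arises in this way.  The closed form of A is a Legendre transform,
   A[phi] + |phi|^2 = sup_h (2 Re (h, phi) - (Ph, h)), so A >= B if and only if
   the resolvent of A is below that of B.  Writing Q = I - P, whose range is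
   that of A, the relation A_L thus corresponds to the largest bounded operator
   Q_L with 0 <= Q_L <= Q and range in L: Krein's shorted operator.  For
   Q_n decreasing strongly to Q, the operators (Q_n)_L decrease, hence converge
   strongly to some S >= Q_L; as S <= Q and the range of S is in L, also
   S <= Q_L. *)
Require Import Defs.
From mathcomp Require Import all_boot all_order all_algebra.
From mathcomp Require Import all_classical all_reals all_analysis.
From mathcomp Require Import ring lra.
(* [ortho] would otherwise be the one of [sesquilinear]. *)
Import Defs.

Set Implicit Arguments.
Unset Strict Implicit.
Unset Printing Implicit Defensive.

Import Order.TTheory GRing.Theory Num.Theory Num.Def.
Import numFieldNormedType.Exports.

Local Open Scope classical_set_scope.
Local Open Scope ring_scope.
Local Open Scope complex_scope.

(** * The real inner product and strong convergence *)

Section RealInner.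
Context {R : realType} {H : hilbertType R}.
Implicit Types (x y z : H) (a : R).

(** All estimates take place in the ordered field [R]; [inner_ip] recovers the complex inner product
    from this real one. *)
Definition ip x y : R := complex.Re (inner x y).
Definition sq x : R := ip x x.

Lemma innerC x y : inner y x = (inner x y)^*%C.
Proof. by have := hermC (@inner R H) y x; rewrite expr0 mul1r. Qed.

Lemma ipC x y : ip y x = ip x y.
Proof. by rewrite /ip innerC; case: (inner x y). Qed.

Lemma ipDl x y z : ip (x + y) z = ip x z + ip y z.
Proof. by rewrite /ip linearDl raddfD. Qed.

Lemma ipNl x z : ip (- x) z = - ip x z.
Proof. by rewrite /ip linearNl raddfN. Qed.

Lemma ipZl a x z : ip (a%:C *: x) z = a * ip x z.
Proof.
by rewrite /ip linearZl_LR /=; case: (inner x z) => u v /=; rewrite mul0r subr0.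
Qed.

Lemma ipDr x y z : ip z (x + y) = ip z x + ip z y.
Proof. by rewrite !(ipC _ z) ipDl. Qed.

Lemma ipNr x z : ip z (- x) = - ip z x.
Proof. by rewrite !(ipC _ z) ipNl. Qed.

Lemma ipZr a x z : ip z (a%:C *: x) = a * ip z x.
Proof. by rewrite !(ipC _ z) ipZl. Qed.

Definition ipE := (ipDl, ipDr, ipNl, ipNr, ipZl, ipZr).

Lemma ip0l x : ip 0 x = 0. Proof. by have := ipDl 0 0 x; rewrite addr0; lra. Qed.
Lemma ip0r x : ip x 0 = 0. Proof. by rewrite ipC ip0l. Qed.

(** Conjugate-linearity turns the factor [i] of the second argument into [- i], which moves the
    imaginary part into the real one. *)
Lemma inner_ip x y : inner x y = (ip x y +i* ip x ('i%C *: y))%C.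
Proof.
rewrite /ip linearZr_LR /= /conjC /=; case: (inner x y) => u v /=.
by congr (_ +i* _)%C; ring.
Qed.

Lemma norm_sq x : `|x| ^+ 2 = (sq x)%:C :> R[i].
Proof.
rewrite -innerxx; have := inner_ip x x => E; rewrite /sq {1}E.
suff -> : ip x ('i%C *: x) = 0 by [].
have : inner x x = (inner x x)^*%C by rewrite -innerC.
by rewrite E /= => -[] ; lra.
Qed.

Lemma sq_ge0 x : 0 <= sq x.
Proof. by rewrite -lecR -norm_sq exprn_ge0. Qed.

Lemma sq0 : sq 0 = 0. Proof. exact: ip0l. Qed.

Lemma sq_eq0 x : sq x = 0 -> x = 0.
Proof.
move=> x0; have /eqP := norm_sq x.
by rewrite x0 /= expf_eq0 normr_eq0 => /eqP.
Qed.

Lemma sqN x : sq (- x) = sq x. Proof. by rewrite /sq !ipE opprK. Qed.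

Lemma sqB x y : sq (x - y) = sq (y - x). Proof. by rewrite -sqN opprB. Qed.

Lemma sqD_le x y : sq (x + y) <= 2 * sq x + 2 * sq y.
Proof. by have := sq_ge0 (x - y); rewrite /sq !ipE (ipC x y); lra. Qed.

(** The discriminant inequality, with the vertex [t = a / b] as test point. The case [b = 0] lets it
    serve for degenerate forms, as in [maximizing_seq]. *)
Lemma quad_disc (a b c : R) : 0 <= b -> 
  (forall t, 2 * t * a - t ^+ 2 * b <= c) -> a ^+ 2 <= c * b.
Proof.
move=> b0 h; have c0 : 0 <= c by have := h 0; lra.
have [b_eq0|bN0] := eqVneq b 0; last first.
  have bp : 0 < b by rewrite lt_neqAle eq_sym bN0.
  have := h (a / b); rewrite -(ler_pM2r bp).
  by have -> : (2 * (a / b) * a - (a / b) ^+ 2 * b) * b = a ^+ 2 by field.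
rewrite b_eq0 in h *; rewrite mulr0.
suff -> : a = 0 by rewrite expr0n.
(* A linear function of [t] bounded above has slope 0: otherwise this [t] gives the value
   [2 (c + 1) > c]. *)
apply/eqP; apply: contraT => a0; have := h ((c + 1) / a).
have -> : 2 * ((c + 1) / a) * a - ((c + 1) / a) ^+ 2 * 0 = 2 * (c + 1) by field.
by lra.
Qed.

Lemma ip_CS x y : ip x y ^+ 2 <= sq x * sq y.
Proof.
apply: quad_disc; first exact: sq_ge0.
move=> t; have := sq_ge0 (x - t%:C *: y).
by rewrite /sq !ipE (ipC x y); lra.
Qed.

Lemma ip_eq0P x : (forall y, ip x y = 0) -> x = 0.
Proof. by move=> h; apply: sq_eq0; exact: h. Qed.

Lemma ip_inj x y : (forall z, ip z x = ip z y) -> x = y.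
Proof.
move=> h; apply/eqP; rewrite -subr_eq0; apply/eqP/ip_eq0P => z.
by rewrite ipC !ipE h subrr.
Qed.

(** Norm convergence through real squared distances; [tendsP] identifies it with convergence in the
    topology of [H]. *)
Definition tends (u : nat -> H) (l : H) : Prop :=
  forall e : R, 0 < e -> exists N, forall n, (N <= n)%N -> sq (u n - l) < e.

Lemma sq_lt_norm x (e : R) : 0 < e -> (`|x| < e%:C :> R[i]) = (sq x < e ^+ 2).
Proof.
move=> e0; rewrite -(@ltr_pXn2r _ 2) ?nnegrE ?normr_ge0 ?lecR ?(ltW e0) //.
by rewrite norm_sq -rmorphXn /= ltcR.
Qed.

Lemma tendsP u l : tends u l <-> u @ \oo --> l.
Proof.
split.
- move=> h; apply/cvgrPdist_lt => e e0.
  have er : e = (complex.Re e)%:C by rewrite RRe_real // gtr0_real.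
  have e0' : 0 < complex.Re e by rewrite -ltcR -er.
  have [|N hN] := h (complex.Re e ^+ 2); first by rewrite exprn_gt0.
  exists N => // n /= /hN; rewrite er sq_lt_norm // -sqN opprB //.
- move=> /cvgrPdist_lt h e e0.
  have s0 : 0 < Num.sqrt e by rewrite sqrtr_gt0.
  have [|N _ hN] := h (Num.sqrt e)%:C; first by rewrite ltcR.
  exists N => n /hN; rewrite sq_lt_norm // sqr_sqrtr ?(ltW e0) // => ?.
  by rewrite -sqN opprB.
Qed.

Lemma tends_uniq u l l' : tends u l -> tends u l' -> l = l'.
Proof. 
move=> h h'; apply/eqP; rewrite -subr_eq0; apply/eqP/sq_eq0/eqP.
rewrite eq_le sq_ge0 andbT; apply/ler_addgt0Pl => e e0; rewrite addr0.
have e4 : 0 < e / 4 by lra.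
have [N hN] := h _ e4; have [N' hN'] := h' _ e4.
have := hN _ (leq_maxl N N'); have := hN' _ (leq_maxr N N').
set n := maxn _ _; have := sqD_le (l - u n) (u n - l').
by rewrite addrA subrK (sqB l (u n)); lra.
Qed.

Lemma tends_complete (u : nat -> H) :
  (forall e : R, 0 < e -> exists N, forall m n, (N <= m)%N -> (N <= n)%N ->
     sq (u m - u n) < e) -> exists l, tends u l.
Proof.
move=> h; suff /cvg_ex[l /tendsP ul] : cvg (u @ \oo) by exists l.
apply/cauchy_cvgP/cauchy_exP => e e0.
have er : e = (complex.Re e)%:C by rewrite RRe_real // gtr0_real.
have e0' : 0 < complex.Re e by rewrite -ltcR -er.
have [|N hN] := h (complex.Re e ^+ 2); first by rewrite exprn_gt0.
exists (u N); exists N => // n /= Nn.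
by rewrite -ball_normE /= er sq_lt_norm // hN.
Qed.

Lemma closed_tends (M : set H) u l : closed M -> (forall n, M (u n)) ->
  tends u l -> M l.
Proof.
move=> cM Mu /tendsP ul; apply: (@closed_cvg _ _ \oo _ u M cM _ l ul); exact: nearW.
Qed.

Lemma closed_tends_pair (M : set (H * H)) u v l k : closed M ->
  (forall n, M (u n, v n)) -> tends u l -> tends v k -> M (l, k).
Proof.
move=> cM Muv /tendsP ul /tendsP vk.
apply: (@closed_cvg _ _ \oo _ (fun n => (u n, v n)) M cM _ (l, k) (cvg_pair ul vk)).
exact: nearW.
Qed.

Lemma nbhs_sq (p : H) (e : R) : 0 < e -> nbhs p [set x | sq (x - p) < e].
Proof.
move=> e0; have s0 : 0 < Num.sqrt e by rewrite sqrtr_gt0.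
have s0' : 0 < (Num.sqrt e)%:C by rewrite ltcR.
apply: filterS (nbhsx_ballx p _ s0') => x.
rewrite -ball_normE. 
rewrite /= sq_lt_norm // sqr_sqrtr ?(ltW e0) // sqB //.
Qed.

Lemma closed_of_approx (M : set H) :
  (forall p, (forall e : R, 0 < e -> exists2 x, M x & sq (x - p) < e) -> M p) ->
  closed M.
Proof.
move=> h p cp; apply: h => e e0.
have [x [Mx xe]] := cp _ (nbhs_sq p e0).
by exists x.
Qed.

Lemma closed_of_approx_pair (M : set (H * H)) :
  (forall p, (forall e : R, 0 < e ->
      exists2 x, M x & sq (x.1 - p.1) < e /\ sq (x.2 - p.2) < e) -> M p) ->
  closed M.
Proof.
move=> h p cp; apply: h => e e0.
pose B (q : H) : set H := [set x : H | sq (x - q) < e].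
have [|x [Mx [xe xe']]] := cp (B p.1 `*` B p.2).
  exists (B p.1, B p.2) => //=.
  by split; apply: nbhs_sq.
by exists x.
Qed.
End RealInner.

(** * Positive contractions and projections *)

Section Effects.
Context {R : realType} {H : hilbertType R}.
Implicit Types (x y z : H) (a : R) (D : set H) (T : H -> H).

Lemma tends_natSinv (r : nat -> R) : (forall n, 0 <= r n < n.+1%:R^-1) ->
  forall e, 0 < e -> exists N, forall n, (N <= n)%N -> r n < e.
Proof.
move=> h e e0; have [N _ hN] := near_infty_natSinv_lt (PosNum e0).
by exists N => n /hN /=; case/andP: (h n) => _; exact: lt_trans.
Qed.

Lemma cvg_of_sqr_lt (r : nat -> R) l :
  (forall e, 0 < e -> exists N, forall n, (N <= n)%N -> (r n - l) ^+ 2 < e) ->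
  r @ \oo --> l.
Proof.
move=> h; apply/cvgrPdist_lt => e e0.
have [|N hN] := h (e ^+ 2); first by rewrite exprn_gt0.
exists N => // n /= /hN.
rewrite -real_normK ?num_real // ltr_pXn2r ?nnegrE ?normr_ge0 ?(ltW e0) //.
by rewrite distrC.
Qed.

Lemma tends_ip (u : nat -> H) l y : tends u l -> (fun n => ip (u n) y) @ \oo --> ip l y.
Proof.
move=> ul; apply: cvg_of_sqr_lt => e e0.
have y1 : 0 < sq y + 1 by have := sq_ge0 y; lra.
have [|N hN] := ul (e / (sq y + 1)); first by rewrite divr_gt0.
exists N => n /hN; rewrite ltr_pdivlMr // => h.
have := ip_CS (u n - l) y; rewrite !ipE.
by have := sq_ge0 (u n - l); lra.
Qed.

Lemma tends_ipr (u : nat -> H) l y : tends u l ->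
  (fun n => ip y (u n)) @ \oo --> ip y l.
Proof.
move=> /(@tends_ip _ _ y); rewrite (ipC y l).
by have -> : (fun n => ip (u n) y) = (fun n => ip y (u n))
  by apply/funext => n; rewrite ipC.
Qed.

Lemma tends_le_ip (u : nat -> H) l y a :
  tends u l -> (forall n, a <= ip (u n) y) -> a <= ip l y.
Proof.
move=> /(@tends_ip _ _ y) h ha; rewrite -(cvg_lim _ h) //.
by apply: limr_ge; [apply/cvg_ex; eexists; exact: h|exact: nearW].
Qed.

Lemma tendsD (u v : nat -> H) l k :
  tends u l -> tends v k -> tends (fun n => u n + v n) (l + k).
Proof. by move=> /tendsP hu /tendsP hv; apply/tendsP; exact: cvgD. Qed.

Lemma tendsN (u : nat -> H) l : tends u l -> tends (fun n => - u n) (- l).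
Proof. by move=> /tendsP hu; apply/tendsP; exact: cvgN. Qed.

Lemma tendsZ (c : R[i]) (u : nat -> H) l :
  tends u l -> tends (fun n => c *: u n) (c *: l).
Proof. by move=> /tendsP hu; apply/tendsP; exact: cvgZr. Qed.

Lemma tends_cst (l : H) : tends (fun=> l) l.
Proof. by apply/tendsP; exact: cvg_cst. Qed.

Definition subspace D := D 0 /\ forall (c : R[i]) x y, D x -> D y -> D (c *: x + y).

(* Symmetry for the real inner product suffices, [T] being complex linear. *)
Record effect T : Prop := Effect {
  eff_lin : linear T;
  eff_sym : forall x y, ip (T x) y = ip x (T y);
  eff_ge0 : forall x, 0 <= ip (T x) x;
  eff_le1 : forall x, ip (T x) x <= sq x }.

Section EffectTheory.
Variable T : H -> H.
Hypothesis hT : effect T.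

Lemma effD x y : T (x + y) = T x + T y.
Proof. by have := eff_lin hT 1 x y; rewrite !scale1r. Qed.
Lemma eff0 : T 0 = 0.
Proof. by apply: (addIr (T 0)); rewrite add0r -effD addr0. Qed.
Lemma effZ (c : R[i]) x : T (c *: x) = c *: T x.
Proof. by have := eff_lin hT c x 0; rewrite eff0 !addr0. Qed.
Lemma effN x : T (- x) = - T x.
Proof. by rewrite -scaleN1r effZ scaleN1r. Qed.
Lemma effB x y : T (x - y) = T x - T y.
Proof. by rewrite effD effN. Qed.

(** Expand [(T (x - T x), x - T x) >= 0] and bound [(T (T x), T x)] by [|T x|^2]. *)
Lemma eff_sq_le x : sq (T x) <= ip (T x) x.
Proof.
have := eff_ge0 hT (x - T x); have := eff_le1 hT (T x).
by rewrite effB /sq !ipE (eff_sym hT (T x) x); lra.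
Qed.

Lemma eff_contr x : sq (T x) <= sq x.
Proof. exact: le_trans (eff_sq_le x) (eff_le1 hT x). Qed.

Lemma eff_tends u l : tends u l -> tends (fun n => T (u n)) (T l).
Proof.
move=> ul e /ul[N hN]; exists N => n /hN; rewrite -effB.
exact: le_lt_trans (eff_contr _).
Qed.

Lemma eff_compl : effect (fun x => x - T x).
Proof.
split=> [c x y|x y|x|x].
- by rewrite (eff_lin hT) scalerBr opprD addrACA.
- by rewrite !ipE (eff_sym hT).
- by rewrite !ipE; have := eff_le1 hT x; rewrite /sq; lra.
- by rewrite !ipE; have := eff_ge0 hT x; rewrite /sq; lra.
Qed.

End EffectTheory.

Lemma eff_id : effect id.
Proof. by split => // x; exact: sq_ge0. Qed.

Lemma subspaceB D x y : subspace D -> D x -> D y -> D (x - y).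
Proof. by move=> [D0 hD] Dx Dy; rewrite addrC -scaleN1r; exact: hD. Qed.
Lemma subspaceD D x y : subspace D -> D x -> D y -> D (x + y).
Proof. by move=> [D0 hD] Dx Dy; rewrite -[x]scale1r; exact: hD. Qed.
Lemma subspaceZ D (c : R[i]) x : subspace D -> D x -> D (c *: x).
Proof. by move=> [D0 hD] Dx; rewrite -[_ *: _]addr0; exact: hD. Qed.

(* A maximizing sequence of the concave functional [2 (h, phi) - (T h, h)]:
   the parallelogram identity makes it Cauchy for the form of [T]. *)
Lemma maximizing_seq D T (phi : H) (c : R) : subspace D -> effect T ->
  (forall h, D h -> 2 * ip h phi - ip (T h) h <= c) ->
  exists u : nat -> H, [/\ forall n, D (u n),
    forall e, 0 < e -> exists N, forall m n, (N <= m)%N -> (N <= n)%N ->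
      ip (T (u m - u n)) (u m - u n) < e &
    forall v, D v -> (fun n => ip (T v) (u n)) @ \oo --> ip v phi].
Proof.
move=> sD hT hc; pose J h := 2 * ip h phi - ip (T h) h.
pose E := [set J h | h in D].
have E0 : E !=set0 by exists (J 0), 0 => //; exact: sD.1.
have Eub : ubound E c by move=> _ [h Dh <-]; exact: hc.
have supE : has_sup E by split => //; exists c.
have Jle h : D h -> J h <= sup E.
  by move=> Dh; apply: (sup_upper_bound supE); exists h.
have /choice[u hu] : forall n, exists h, D h /\ sup E - n.+1%:R^-1 < J h.
  move=> n; have [|_ [h Dh <-] ?] := @sup_adherent _ _ n.+1%:R^-1 _ supE.
    by rewrite invr_gt0 ltr0Sn.
  by exists h.
have Du n : D (u n) by case: (hu n).
pose d n := sup E - J (u n).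
have d0 n : 0 <= d n by rewrite /d subr_ge0 Jle.
have dlim : forall e, 0 < e -> exists N, forall n, (N <= n)%N -> d n < e.
  apply: tends_natSinv => n; rewrite d0 /d /= ltrBlDr -ltrBlDl.
  by case: (hu n).
exists u; split => //.
- move=> e e0; have [|N hN] := dlim (e / 4); first by lra.
  exists N => m n /hN hm /hN hn.
  (* At the midpoint, [J] exceeds the mean of its two values by a quarter of the form of [T] at
     [u m - u n]. So that form is at most [2 (d m + d n) < e]. *)
  have : J (2^-1%:C *: (u m + u n)) <= sup E.
    by apply: Jle; apply: subspaceZ => //; exact: subspaceD.
  move: hm hn; rewrite /d /J (effZ hT) (effB hT) (effD hT) !ipE.
  by rewrite (eff_sym hT (u n) (u m)) (ipC _ (u n)); lra.
- move=> v Dv; apply: cvg_of_sqr_lt => e e0.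
  have b0 : 0 < ip (T v) v + 1 by have := eff_ge0 hT v; lra.
  have [|N hN] := dlim (e / (ip (T v) v + 1)); first by rewrite divr_gt0.
  exists N => n /hN; rewrite ltr_pdivlMr // => h.
  (* First variation: [J (u n + t v) <= sup E] for all real [t] is a quadratic inequality in [t]
     with constant term [d n]. *)
  have : (ip v phi - ip (T v) (u n)) ^+ 2 <= d n * ip (T v) v.
    apply: quad_disc; first exact: eff_ge0.
    move=> t; have : J (u n + t%:C *: v) <= sup E.
      by apply: Jle; apply: subspaceD => //; exact: subspaceZ.
    rewrite /d /J (effD hT) (effZ hT) !ipE.
    by rewrite (eff_sym hT (u n) v) (ipC (T v) (u n)); lra.
  by have := d0 n; lra.
Qed.

(** The sequential closure, so that one can project onto the closure of a range. *)
Definition adherent D w := exists2 u : nat -> H, forall n, D (u n) & tends u w.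

(** Take [T = id] in [maximizing_seq]: since [2 (h, x) - |h|^2 = |x|^2 - |x - h|^2], the sequence
    minimizes the distance to [x] and is Cauchy, and the limit of the first variation is
    orthogonality. *)
Lemma projection D x : subspace D ->
  exists2 w, adherent D w & forall d, D d -> ip d (x - w) = 0.
Proof.
move=> sD; have [|u [Du cu hu]] := @maximizing_seq D id x (sq x) sD eff_id.
  by move=> h _; have := sq_ge0 (x - h); rewrite /sq !ipE (ipC h x); lra.
have [w uw] := tends_complete cu.
exists w; first by exists u.
move=> d /hu ud; rewrite !ipE; apply/eqP; rewrite subr_eq0; apply/eqP.
exact: (cvg_unique _ ud (tends_ipr (y := d) uw)).
Qed.

Lemma adherent_ortho D w z : adherent D w -> (forall d, D d -> ip d z = 0) ->
  ip w z = 0.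
Proof.
move=> [u Du uw] h; apply: (cvg_unique _ (tends_ip (y := z) uw)) => //.
have -> : (fun n => ip (u n) z) = (fun=> 0) by apply/funext => n; exact: h.
exact: cvg_cst.
Qed.

Lemma adherent_closed D w : closed D -> adherent D w -> D w.
Proof. by move=> cD [u Du]; exact: closed_tends. Qed.

(** As [D] is stable under multiplication by [i], vanishing of the real parts on [D] entails that of
    the imaginary parts. *)
Lemma orthoP D x : subspace D -> ortho D x <-> forall d, D d -> ip d x = 0.
Proof.
move=> sD; split=> h d Dd; first by rewrite ipC /ip h.
by rewrite inner_ip !(ipC _ x) !h //; exact: subspaceZ.
Qed.

Lemma ortho_subspace D : subspace (ortho D).
Proof.
split=> [y _|c x y hx hy z Dz]; first by rewrite linear0l.
by rewrite linearDl linearZl_LR /= hx // hy // mulr0 addr0.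
Qed.

Lemma ortho_closed D : subspace D -> closed (ortho D).
Proof.
move=> sD; apply: closed_of_approx => p hp; apply/orthoP => // d Dd.
apply/eqP; rewrite -sqrf_eq0 eq_le sqr_ge0 andbT.
apply/ler_addgt0Pl => e e0; rewrite addr0.
have d1 : 0 < sq d + 1 by have := sq_ge0 d; lra.
have [|x /(orthoP _ sD) hx xp] := hp (e / (sq d + 1)); first by rewrite divr_gt0.
have := ip_CS (x - p) d; rewrite !ipE (ipC d x) hx // (ipC d p) sub0r sqrrN.
move: xp; rewrite ltr_pdivlMr //.
by have := sq_ge0 (x - p); lra.
Qed.

Lemma ortho_ortho D x : subspace D -> closed D -> ortho (ortho D) x -> D x.
Proof.
move=> sD cD; move=> /(orthoP _ (ortho_subspace D)) h.
have [w /(adherent_closed cD) Dw /(orthoP _ sD) hw] := projection x sD.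
suff -> : x = w by [].
apply/eqP; rewrite -subr_eq0; apply/eqP/sq_eq0.
by rewrite /sq ipDr ipNr (h _ hw) (ipC w) ((orthoP _ sD).1 hw) // subrr.
Qed.

Lemma closed_subspaceP D : closed_subspace D <-> subspace D /\ closed D.
Proof.
split=> -[]; last first.
  move=> [D0 hD] cD; split => //; split; first by rewrite in_setE.
  by move=> c x y; rewrite !in_setE; exact: hD.
move=> [D0 hD] cD; split => //; split; first by move: D0; rewrite in_setE.
by move=> c x y Dx Dy; have := hD c x y; rewrite !in_setE; exact.
Qed.

End Effects.

(** * Square roots of positive contractions *)

Section Sqrt.
Context {R : realType} {H : hilbertType R}.
Implicit Types (x y z : H) (a : R) (D : set H) (T : H -> H).

(** The sequence [r] is increasing and bounded, hence Cauchy, and it controls the increments of [u].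
    This serves decreasing sequences of effects as well as the square root iteration. *)
Lemma monotone_cvg (u : nat -> H) (r : nat -> R) (c : R) :
  (forall n, r n <= c) ->
  (forall m n, (m <= n)%N -> sq (u n - u m) <= r n - r m) ->
  exists l, tends u l.
Proof.
move=> rc hur; pose E := range r.
have supE : has_sup E.
  by split; [exists (r 0%N), 0%N|exists c => _ [n _ <-]; exact: rc].
have rle n : r n <= sup E by apply: (sup_upper_bound supE); exists n.
have rmono m n : (m <= n)%N -> r m <= r n.
  by move=> /hur h; have := sq_ge0 (u n - u m); lra.
apply: tends_complete => e e0.
have [_ [N _ <-] hN] := sup_adherent e0 supE.
exists N; suff h m n : (N <= m)%N -> (m <= n)%N -> sq (u n - u m) < e.
  move=> m n Nm Nn; case: (leqP m n) => [mn|/ltnW nm]; last exact: h.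
  by rewrite sqB; exact: h.
move=> Nm mn; apply: le_lt_trans (hur _ _ mn) _.
by have := rmono _ _ Nm; have := rle n; lra.
Qed.

Lemma effect_lim (T : nat -> H -> H) : (forall n, effect (T n)) ->
  (forall x, exists l, tends (T^~ x) l) ->
  exists S, effect S /\ forall x, tends (T^~ x) (S x).
Proof.
move=> hT /choice[S hS]; exists S; split => //.
have ip0 x y : (fun n => ip (T n x) y) @ \oo --> ip (S x) y.
  exact: tends_ip (hS x).
split=> [c x y|x y|x|x].
- apply: tends_uniq (hS _) _.
  have -> : T^~ (c *: x + y) = fun n => c *: T n x + T n y.
    by apply/funext => n; rewrite (eff_lin (hT n)).
  by apply: tendsD (hS y); exact: tendsZ.
- apply: (cvg_unique _ (ip0 x y)) => //.
  have -> : (fun n => ip (T n x) y) = fun n => ip x (T n y).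
    by apply/funext => n; rewrite (eff_sym (hT n)).
  exact: tends_ipr (hS y).
- by apply: (tends_le_ip (y := x) (hS x)) => n; exact: eff_ge0.
- rewrite -lerN2 -(ipNl (S x)); apply: (tends_le_ip (y := x) (tendsN (hS x))) => n.
  by rewrite ipNl lerN2; exact: eff_le1.
Qed.

(** The contractions [T n] send [u n - l] to a null sequence; what remains is pointwise convergence
    at [l]. *)
Lemma tends_comp (T : nat -> H -> H) S u l : (forall n, effect (T n)) ->
  (forall x, tends (T^~ x) (S x)) -> tends u l ->
  tends (fun n => T n (u n)) (S l).
Proof.
move=> hT hS ul; rewrite -[S l]add0r.
have -> : (fun n => T n (u n)) = fun n => T n (u n - l) + T n l.
  by apply/funext => n; rewrite -effD // subrK.
apply: tendsD (hS l) => e /ul[N hN]; exists N => n /hN.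
by rewrite subr0; apply: le_lt_trans; exact: eff_contr.
Qed.

(** For [m <= n] the difference [T m - T n] is again an effect, so [eff_sq_le] bounds its squared
    norm at [x] by the decrease of the forms at [x]. *)
Lemma decreasing_effect_cvg (T : nat -> H -> H) : (forall n, effect (T n)) ->
  (forall m n x, (m <= n)%N -> ip (T n x) x <= ip (T m x) x) ->
  exists S, effect S /\ forall x, tends (T^~ x) (S x).
Proof.
move=> hT mT; apply: effect_lim => // x.
apply: (@monotone_cvg _ (fun n => - ip (T n x) x) 0) => [n|m n mn].
  by rewrite oppr_le0 eff_ge0.
have hD : effect (fun x => T m x - T n x).
  split=> [c y z|y z|y|y].
  - by rewrite !(eff_lin (hT _)) scalerBr opprD addrACA.
  - by rewrite !ipE !(eff_sym (hT _)).
  - by rewrite !ipE; have := mT _ _ y mn; lra.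
  - by rewrite !ipE; have := eff_le1 (hT m) y; have := eff_ge0 (hT n) y; lra.
by have := eff_sq_le hD x; rewrite sqB !ipE; lra.
Qed.

Definition nm x := Num.sqrt (sq x).

Lemma nm_ge0 x : 0 <= nm x. Proof. exact: sqrtr_ge0. Qed.

Lemma nmX x : nm x ^+ 2 = sq x. Proof. by rewrite sqr_sqrtr // sq_ge0. Qed.

Lemma nmD x y : nm (x + y) <= nm x + nm y.
Proof.
rewrite -(@ler_pXn2r _ 2) ?nnegrE ?addr_ge0 ?nm_ge0 // nmX.
have : ip x y <= nm x * nm y.
  apply: le_trans (ler_norm _) _.
  rewrite -(@ler_pXn2r _ 2) ?nnegrE ?mulr_ge0 ?nm_ge0 ?normr_ge0 //.
  by rewrite real_normK ?num_real // exprMn !nmX ip_CS.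
by rewrite sqrrD !nmX /sq !ipE (ipC x y); lra.
Qed.

Lemma nmZ a x : 0 <= a -> nm (a%:C *: x) = a * nm x.
Proof.
move=> a0; rewrite /nm /sq !ipE mulrA -expr2 sqrtrM ?sqr_ge0 //.
by rewrite sqrtr_sqr ger0_norm.
Qed.

Lemma nm_le x y a : 0 <= a -> (nm x <= a * nm y) = (sq x <= a ^+ 2 * sq y).
Proof.
move=> a0; rewrite -(@ler_pXn2r _ 2) ?nnegrE ?mulr_ge0 ?nm_ge0 //.
by rewrite exprMn !nmX.
Qed.

Section Iteration.
Variable T : H -> H.
Hypothesis hT : effect T.

Let X x := x - T x.
Let hX : effect X. Proof. exact: eff_compl. Qed.

(** Polynomials in [T] approximating [1 - sqrt T]; they commute with each other and with every
    effect commuting with [T]. *)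
Fixpoint sqrt_iter n x : H :=
  if n is n'.+1 then 2^-1%:C *: (x - T x + sqrt_iter n' (sqrt_iter n' x)) else 0.

(** The scalar iteration with 1 in place of [1 - T]; it bounds the operator norms of [sqrt_iter] and
    of its increments. *)
Fixpoint sqrt_bound n : R := if n is n'.+1 then (1 + sqrt_bound n' ^+ 2) / 2 else 0.

Lemma sqrt_iter_effect n : effect (sqrt_iter n).
Proof.
elim: n => [|n IH] /=.
  split=> [c x y|x y|x|x] /=; rewrite ?scaler0 ?addr0 ?ip0l ?ip0r //.
  exact: sq_ge0.
split=> [c x y|x y|x|x].
- rewrite !(eff_lin IH, eff_lin hT) opprD (addrACA (c *: x)) -scalerBr.
  by rewrite (addrACA (c *: _)) -scalerDr [LHS]scalerDr !scalerA mulrC.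
- by rewrite !ipE !(eff_sym IH) (eff_sym hT).
- rewrite !ipE (eff_sym IH); have := eff_le1 hT x.
  by have := sq_ge0 (sqrt_iter n x); rewrite /sq; lra.
- rewrite !ipE (eff_sym IH); have := eff_ge0 hT x.
  by have := eff_contr IH x; rewrite /sq; lra.
Qed.

Lemma sqrt_iter_comm C n x : effect C -> (forall x, C (T x) = T (C x)) ->
  C (sqrt_iter n x) = sqrt_iter n (C x).
Proof.
move=> hC CT; elim: n x => [|n IH] x /=; first exact: eff0.
by rewrite effZ // effD // effB // CT !IH.
Qed.

Lemma sqrt_bound_itv n : 0 <= sqrt_bound n <= 1.
Proof.
elim: n => [|n /andP[IH0 IH1]] /=; first by rewrite lexx ler01.
by apply/andP; split; nra.
Qed.

Lemma sqrt_iter_le n x : nm (sqrt_iter n x) <= sqrt_bound n * nm x.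
Proof.
elim: n x => [|n IH] x /=; first by rewrite /nm sq0 sqrtr0 mul0r.
have /andP[c0 c1] := sqrt_bound_itv n.
rewrite nmZ ?invr_ge0 ?ler0n //.
have h1 := nmD (x - T x) (sqrt_iter n (sqrt_iter n x)).
have h2 : nm (x - T x) <= nm x.
  by rewrite -[leRHS]mul1r nm_le // expr1n mul1r (eff_contr hX).
have h3 : nm (sqrt_iter n (sqrt_iter n x)) <= sqrt_bound n ^+ 2 * nm x.
  by apply: le_trans (IH _) _; rewrite expr2 -mulrA ler_wpM2l.
by lra.
Qed.

Lemma sqrt_iter_selfcomm m n x :
  sqrt_iter m (sqrt_iter n x) = sqrt_iter n (sqrt_iter m x).
Proof.
apply: sqrt_iter_comm; first exact: sqrt_iter_effect.
by move=> y; rewrite sqrt_iter_comm.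
Qed.

(** Since consecutive iterates commute, [V'' - V' = (V' + V) (V' - V) / 2]. The scalar iteration
    satisfies the same identity, and the factors are compared one by one. *)
Lemma sqrt_iter_step n x : nm (sqrt_iter n.+1 x - sqrt_iter n x) <=
  (sqrt_bound n.+1 - sqrt_bound n) * nm x.
Proof.
elim: n x => [|n IH] x.
  rewrite [sqrt_iter 0 x]/= [sqrt_bound 0]/= !subr0; exact: sqrt_iter_le.
have uv : sqrt_iter n.+1 (sqrt_iter n x) = sqrt_iter n (sqrt_iter n.+1 x).
  exact: sqrt_iter_selfcomm.
pose z := sqrt_iter n.+1 x - sqrt_iter n x.
have -> : sqrt_iter n.+2 x - sqrt_iter n.+1 x =
    2^-1%:C *: (sqrt_iter n.+1 z + sqrt_iter n z).
  have e1 : sqrt_iter n.+2 x =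
    2^-1%:C *: (x - T x + sqrt_iter n.+1 (sqrt_iter n.+1 x)) by [].
  have e2 : sqrt_iter n.+1 x =
    2^-1%:C *: (x - T x + sqrt_iter n (sqrt_iter n x)) by [].
  rewrite e1 {2}e2 /z -scalerBr; congr (_ *: _).
  move: (sqrt_iter_effect n.+1) (sqrt_iter_effect n) uv.
  move: (sqrt_iter n.+1) (sqrt_iter n) => u v hu hv uv.
  rewrite (effB hu) (effB hv) uv [RHS]addrA subrK.
  by rewrite opprD addrACA subrr add0r.
rewrite nmZ ?invr_ge0 ?ler0n //.
have h := nmD (sqrt_iter n.+1 z) (sqrt_iter n z).
have hu1 := sqrt_iter_le n.+1 z; have hv1 := sqrt_iter_le n z.
have /andP[c0 c1] := sqrt_bound_itv n; have /andP[d0 d1] := sqrt_bound_itv n.+1.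
have := IH x; rewrite -/z.
have -> : sqrt_bound n.+2 - sqrt_bound n.+1 =
    (sqrt_bound n.+1 + sqrt_bound n) * (sqrt_bound n.+1 - sqrt_bound n) / 2.
  by rewrite /=; field.
move: h; move: (sqrt_iter n.+1 z) (sqrt_iter n z) hu1 hv1 => u v hu1 hv1 h.
move: (sqrt_bound n.+1) (sqrt_bound n) d0 c0 hu1 hv1 => d c d0 c0 hu1 hv1 hz.
have : (d + c) * nm z <= (d + c) * ((d - c) * nm x) by apply: ler_wpM2l => //; lra.
by lra.
Qed.

Lemma sqrt_bound_le m n : (m <= n)%N -> sqrt_bound m <= sqrt_bound n.
Proof.
elim: n => [|n IH]; first by rewrite leqn0 => /eqP->.
rewrite leq_eqVlt => /orP[/eqP-> //|/IH h]; apply: le_trans h _ => /=.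
by have := sqr_ge0 (sqrt_bound n - 1); lra.
Qed.

Lemma sqrt_iter_dist m n x : (m <= n)%N ->
  nm (sqrt_iter n x - sqrt_iter m x) <= (sqrt_bound n - sqrt_bound m) * nm x.
Proof.
elim: n => [|n IH].
  by rewrite leqn0 => /eqP->; rewrite !subrr mul0r /nm sq0 sqrtr0.
rewrite leq_eqVlt => /orP[/eqP->|/IH h].
  by rewrite !subrr mul0r /nm sq0 sqrtr0.
have h1 := sqrt_iter_step n x.
have := nmD (sqrt_iter n.+1 x - sqrt_iter n x) (sqrt_iter n x - sqrt_iter m x).
by rewrite addrA subrK; lra.
Qed.

Lemma sqrt_iter_cvg x : exists l, tends (sqrt_iter^~ x) l.
Proof.
apply: (@monotone_cvg _ (fun n => sqrt_bound n * sq x) (sq x)) => [n|m n mn].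
  by have /andP[_ c1] := sqrt_bound_itv n; rewrite ler_piMl ?sq_ge0.
have h := sqrt_bound_le mn.
have := sqrt_iter_dist x mn; rewrite nm_le ?subr_ge0 // => /le_trans; apply.
rewrite -mulrBl ler_wpM2r ?sq_ge0 //.
have /andP[c0 c1] := sqrt_bound_itv n; have /andP[d0 d1] := sqrt_bound_itv m.
(* The increments of [sqrt_bound] lie in [[0, 1]], so their squares do not exceed them. *)
by rewrite expr2 ler_piMl ?subr_ge0 //; lra.
Qed.

End Iteration.

(* [1 - sqrt T] is the limit of the increasing solution of
   [V = (1 - T + V ^ 2) / 2] by iteration from [0]; the increments are
   dominated by those of the scalar iteration for [T = 0]. *)
Lemma effect_sqrt T : effect T -> exists Y, [/\ effect Y,
  forall x, Y (Y x) = T x &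
  forall C, effect C -> (forall x, C (T x) = T (C x)) ->
    forall x, C (Y x) = Y (C x)].
Proof.
move=> hT.
have hi := sqrt_iter_effect hT.
have [V [hV limV]] := effect_lim hi (sqrt_iter_cvg hT).
have VE x : V x = 2^-1%:C *: (x - T x + V (V x)).
  have lim1 : tends (fun n => sqrt_iter T n.+1 x) (V x).
    move=> e e0; have [N hN] := limV x e e0.
    by exists N => n Nn; apply: (hN n.+1); exact: leqW.
  apply: (tends_uniq lim1).
  apply: (@tendsZ _ _ _ (fun n => x - T x + sqrt_iter T n (sqrt_iter T n x))).
  apply: tendsD; first exact: tends_cst.
  exact: tends_comp hi limV (limV x).
exists (fun x => x - V x); split=> [|x|C hC CT x]; first exact: eff_compl.
(* The fixed-point equation [2 V = 1 - T + V^2] rearranges to [(1 - V)^2 = T]. *)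
- have V2 : V x + V x = x - T x + V (V x).
    rewrite [in LHS]VE -scalerDl -rmorphD /=.
    by rewrite (_ : 2^-1 + 2^-1 = 1 :> R) ?scale1r //; field.
  have -> : x - V x - V (x - V x) = x - (V x + V x) + V (V x).
    by rewrite (effB hV) opprB addrACA -opprD addrAC.
  by rewrite V2 opprD addrA subrK subKr.
- rewrite effB //; congr (_ - _).
  apply: tends_uniq (eff_tends hC (limV x)) _.
  have -> : (fun n => C (sqrt_iter T n x)) = fun n => sqrt_iter T n (C x).
    by apply/funext => n; rewrite sqrt_iter_comm.
  exact: limV.
Qed.

End Sqrt.

(** * Relations and their resolvents *)

Section Relations.
Context {R : realType} {H : hilbertType R}.
Implicit Types (x y z : H) (a : R) (D : set H) (T P : H -> H) (A S : set (H * H)).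

(** The relation [P^-1 - I]: a pair [(f, f')] belongs to it when it is [(P h, h - P h)] for
    [h = f + f']. *)
Definition rel P : set (H * H) := [set p | P (p.1 + p.2) = p.1].

Definition res A : H -> H := value (resolvent A).

Lemma eff_inner T x y : effect T -> inner (T x) y = inner x (T y).
Proof. by move=> hT; rewrite !inner_ip -(effZ hT) !(eff_sym hT). Qed.

(** Nonnegativity in [R[i]] includes being real, which the symmetry hypothesis supplies. *)
Lemma inner_ge0 x y : inner y x = inner x y -> 0 <= ip x y -> 0 <= inner x y.
Proof.
rewrite innerC /ip lecE /=; case: (inner x y) => u v /= [uv] ->.
by rewrite andbT; apply/eqP; lra.
Qed.

Lemma closed_subspace2P A : closed_subspace A <->
  [/\ A (0, 0), forall (c : R[i]) p q, A p -> A q ->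
        A (c *: p.1 + q.1, c *: p.2 + q.2) & closed A].
Proof.
split=> [[[A0 hA] cA]|[A0 hA cA]].
  split => // [|c p q Ap Aq]; first by move: A0; rewrite in_setE.
  have := hA c p q; rewrite !in_setE => /(_ Ap Aq).
  by case: p q {Ap Aq} => [p1 p2] [q1 q2].
split => //; split; first by rewrite in_setE.
move=> c [p1 p2] [q1 q2]; rewrite !in_setE => Ap Aq.
exact: (hA c _ _ Ap Aq).
Qed.

Section NonnegSelfadjoint.
Variable (K : set H) (A : set (H * H)).
Hypothesis hA : nonneg_selfadjoint K A.

Lemma nsaE g : A g = ((K `*` K) g /\
  forall f, A f -> inner f.2 g.1 = inner f.1 g.2).
Proof. by case: hA => _ sA _; rewrite [in LHS]sA. Qed.

Lemma nsa_sym f g : A f -> A g -> inner f.2 g.1 = inner f.1 g.2.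
Proof. by move=> Af; rewrite nsaE => -[_]; exact. Qed.

Lemma nsa_ip_sym f f' g g' : A (f, f') -> A (g, g') -> ip f' g = ip f g'.
Proof. by move=> Af Ag; rewrite /ip (nsa_sym Af Ag). Qed.

Lemma nsa_ge0 f f' : A (f, f') -> 0 <= ip f' f.
Proof.
by case: hA => _ _ nA /nA /=; rewrite lecE => /andP[_].
Qed.

Lemma nsa_lin (c : R[i]) f f' g g' : A (f, f') -> A (g, g') ->
  A (c *: f + g, c *: f' + g').
Proof. by case: hA => -[/closed_subspace2P[_ h _] _ _ _] Af; exact: (h c _ _ Af). Qed.

Lemma nsa_sub f f' g g' : A (f, f') -> A (g, g') -> A (f - g, f' - g').
Proof.
move=> Af Ag; rewrite (addrC f) (addrC f') -(scaleN1r g) -(scaleN1r g').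
exact: nsa_lin.
Qed.

Lemma nsa0 : A (0, 0).
Proof. by case: hA => -[/closed_subspace2P[]]. Qed.

Lemma nsa_closed : closed A.
Proof. by case: hA => -[/closed_subspace2P[]]. Qed.

End NonnegSelfadjoint.

(** The range [M] of [A + I] is all of [H]: it is closed because [A] is closed and nonnegative, and
    dense because [A] is selfadjoint and nonnegative. *)
Lemma resP A h : nonneg_selfadjoint setT A -> A (res A h, h - res A h).
Proof.
move=> hA.
pose M := [set h | exists f f', A (f, f') /\ h = f' + f].
have sM : subspace M.
  split; first by exists 0, 0; split; [exact: nsa0 hA|rewrite addr0].
  move=> c _ _ [f [f' [Af ->]]] [g [g' [Ag ->]]].
  exists (c *: f + g), (c *: f' + g'); split; first exact: (nsa_lin hA _ Af Ag).
  by rewrite scalerDr addrACA.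
have [w [u /choice[f hf] uw] hw] := projection h sM.
have {hf} /choice[f' hf] : forall n, exists f', A (f n, f') /\ u n = f' + f n.
  exact: hf.
(* Nonnegativity makes the cross term in [|d' + d|^2] nonnegative, so [f] inherits the Cauchy
   property of [u]. *)
have fu m n : sq (f m - f n) <= sq (u m - u n).
  have [Am ->] := hf m; have [An ->] := hf n.
  have -> : f' m + f m - (f' n + f n) = (f' m - f' n) + (f m - f n).
    by rewrite opprD addrACA.
  have := nsa_ge0 hA (nsa_sub hA Am An).
  move: (f m - f n) (f' m - f' n) => d d' dd.
  by rewrite /sq !ipE (ipC d' d); have := sq_ge0 d'; rewrite /sq; lra.
have [k fk] : exists k, tends f k.
  apply: tends_complete => e e0.
  have [|N hN] := uw (e / 4); first by lra.
  exists N => m n /hN hm /hN hn; apply: le_lt_trans (fu _ _) _.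
  have -> : u m - u n = (u m - w) + (w - u n) by rewrite addrA subrK.
  apply: le_lt_trans (sqD_le _ _) _.
  by rewrite (sqB w); lra.
have Ak : A (k, w - k).
  apply: (closed_tends_pair (nsa_closed hA) _ fk (tendsD uw (tendsN fk))) => n /=.
  by have [An ->] := hf n; rewrite addrK.
have hgw : h = w.
  pose g := h - w; have Ag : A (g, - g).
    (* Orthogonality of [g] to [M] says that [(g, - g)] lies in the adjoint, that is, in [A];
       nonnegativity then yields [- |g|^2 >= 0]. *)
    rewrite (nsaE hA); split => // -[k1 k2] Ak12 /=.
    have /(orthoP _ sM) hg : forall d, M d -> ip d g = 0 by [].
    have : inner (k2 + k1) g = 0.
      rewrite innerC hg; first by rewrite conjc0.
      by exists k1, k2.
    by rewrite linearDl linearNr => /eqP; rewrite addr_eq0 => /eqP.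
  have := nsa_ge0 hA Ag; rewrite ipNl => g0.
  apply/eqP; rewrite -subr_eq0 -/g; apply/eqP/sq_eq0.
  by have := sq_ge0 g; rewrite /sq in g0 *; lra.
have ex : exists y, resolvent A (h, y).
  by exists k, k, (w - k); split => //; rewrite subrK hgw.
rewrite /res /value; have [f1 [f1' [Af [-> e]]]] := xgetPex 0 ex.
by rewrite e addrK.
Qed.

(** Two elements of [A] with the same sum of components differ by a pair [(d, - d)], and
    nonnegativity forces [d = 0]. *)
Lemma resE A f f' : nonneg_selfadjoint setT A -> A (f, f') -> res A (f + f') = f.
Proof.
move=> hA Af; have := nsa_ge0 hA (nsa_sub hA (resP (f + f') hA) Af).
set g := res A (f + f'); have -> : f + f' - g - f' = - (g - f).
  by rewrite addrAC addrK opprB.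
rewrite ipNl => h; apply/eqP; rewrite -subr_eq0; apply/eqP/sq_eq0.
by have := sq_ge0 (g - f); rewrite /sq in h *; lra.
Qed.

Lemma res_effect A : nonneg_selfadjoint setT A -> effect (res A).
Proof.
move=> hA; have hP := fun h => resP h hA.
split=> [c x y|x y|x|x].
- rewrite -(resE hA (nsa_lin hA c (hP x) (hP y))).
  by congr (res A _); rewrite addrACA -scalerDr !(addrC (res A _)) !subrK.
- by have := nsa_ip_sym hA (hP x) (hP y); rewrite !ipE; lra.
- by have := nsa_ge0 hA (hP x); rewrite !ipE (ipC x);
    have := sq_ge0 (res A x); rewrite /sq; lra.
- have := nsa_ge0 hA (hP x); rewrite !ipE (ipC x).
  by have := sq_ge0 (x - res A x); rewrite /sq !ipE (ipC x); lra.
Qed.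

Lemma nsa_rel A : nonneg_selfadjoint setT A -> A = rel (res A).
Proof.
move=> hA; apply/seteqP; split=> -[f f'] /=; first exact: resE.
by move=> e; have := resP (f + f') hA; rewrite /rel /= in e *; rewrite e addrC addKr.
Qed.

Lemma rel_nsa P : effect P -> nonneg_selfadjoint setT (rel P).
Proof.
move=> hP; split.
- split; last by [].
  apply/closed_subspace2P; split.
  + by rewrite /rel /= addr0 eff0.
  + move=> c [p p'] [q q']; rewrite /rel /= => hp hq.
    by rewrite addrACA -scalerDr (eff_lin hP) hp hq.
  + apply: closed_of_approx_pair => -[p p'] hp; rewrite /rel /=.
    apply/eqP; rewrite -subr_eq0; apply/eqP/sq_eq0/eqP.
    rewrite eq_le sq_ge0 andbT; apply/ler_addgt0Pl => e e0; rewrite addr0.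
    have [|[x x']] := hp (e / 16); first by lra.
    rewrite /rel /= => hx [xp xp'].
    have -> : P (p + p') - p = P ((p - x) + (p' - x')) + (x - p).
      by rewrite addrACA -opprD (effB hP) hx addrA subrK.
    apply: le_trans (sqD_le _ _) _.
    have := eff_contr hP ((p - x) + (p' - x')).
    by have := sqD_le (p - x) (p' - x'); rewrite (sqB p) (sqB p'); lra.
- apply/seteqP; split=> -[g g'] /=.
    move=> Ag; split => // -[f f']; rewrite /rel /= in Ag * => Af.
    move: Ag Af (eff_inner (f + f') (g + g') hP) => /= -> ->.
    by rewrite linearDl linearDr => /addrI.
  move=> [_ h]; rewrite /rel /=.
  (* The pairs [(P z, z - P z)] lie in the relation, so they are admissible tests for membership in
     the adjoint. *)
  apply: ip_inj => z; have /h : rel P (P z, z - P z).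
    by rewrite /rel /= addrC subrK.
  move=> /(congr1 (@complex.Re _)); rewrite -!/(ip _ _) /= (effD hP) !ipE.
  by rewrite !(eff_sym hP); lra.
- move=> -[f f']; rewrite /rel /= => Af.
  have [ef ef'] : f = P (f + f') /\ f' = (f + f') - P (f + f').
    by rewrite Af addrC addKr.
  move: (f + f') ef ef' => h -> -> {f f' Af}.
  apply: inner_ge0.
    by have /= -> := eff_inner h (P h) (eff_compl hP); rewrite eff_inner // (effB hP).
  by have := eff_sq_le hP h; rewrite !ipE (ipC (P h)) /sq; lra.
Qed.

Lemma res_rel P : effect P -> res (rel P) = P.
Proof.
move=> hP; apply/funext => h.
have := resP h (rel_nsa hP); rewrite /rel /=.
by rewrite addrC subrK.
Qed.

End Relations.

(** * Forms and their order *)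

Section Forms.
Context {R : realType} {H : hilbertType R}.
Implicit Types (x y z h phi : H) (D : set H) (T P : H -> H) (A S : set (H * H)).

Lemma closed_approx D p : closed D ->
  (forall e, 0 < e -> exists2 x, D x & sq (x - p) < e) -> D p.
Proof.
move=> cD h; have /choice[u hu] : forall n, exists x, D x /\ sq (x - p) < n.+1%:R^-1.
  by move=> n; have [|x Dx xp] := h n.+1%:R^-1; [rewrite invr_gt0 ltr0Sn|exists x].
apply: (closed_tends cD (u := u)) => [n|]; first by case: (hu n).
by apply: tends_natSinv => n; rewrite sq_ge0; case: (hu n).
Qed.

Lemma mulP A m : nonneg_selfadjoint setT A -> mul A m <-> res A m = 0.
Proof. by move=> hA; rewrite [in mul A](nsa_rel hA) /mul /rel /= add0r. Qed.

Lemma mul_subspace A : nonneg_selfadjoint setT A -> subspace (mul A).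
Proof.
move=> hA; have hP := res_effect hA; split; first exact: nsa0 hA.
move=> c x y /(mulP _ hA) hx /(mulP _ hA) hy.
by apply/(mulP _ hA); rewrite (eff_lin hP) hx hy scaler0 addr0.
Qed.

Lemma mul_closed A : nonneg_selfadjoint setT A -> closed (mul A).
Proof.
move=> hA; have hP := res_effect hA; apply: closed_of_approx => p hp; apply/(mulP _ hA).
apply/sq_eq0/eqP; rewrite eq_le sq_ge0 andbT; apply/ler_addgt0Pl => e e0.
have [x /(mulP _ hA) hx xp] := hp _ e0; rewrite addr0.
rewrite -[res A p]subr0 -hx -(effB hP).
by apply: le_trans (eff_contr hP _) _; rewrite sqB ltW.
Qed.

(** With [P = res A], [Z = sqrt P] and [W = sqrt (1 - P)], the root is formally [W Z^-1] on the
    orthogonal complement [K] of [mul A], which is the kernel of [P]; there [Z] is injective. *)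
Lemma is_sqrt_exists A : nonneg_selfadjoint setT A -> exists S, is_sqrt A S.
Proof.
move=> hA; have hP := res_effect hA.
have [Z [hZ ZZ Zcomm]] := effect_sqrt hP.
have [W [hW WW Wcomm]] := effect_sqrt (eff_compl hP).
(* The root [Y] of [Z] is there to show that the product [W Z] is nonnegative. *)
have [Y [hY YY Ycomm]] := effect_sqrt hZ.
have ZP x : Z (res A x) = res A (Z x) by rewrite -!ZZ.
have ZW x : Z (W x) = W (Z x).
  by apply: Wcomm => // y; rewrite (effB hZ) ZP.
have WY x : W (Y x) = Y (W x) by apply: Ycomm => // y; rewrite ZW.
have kerZ y : res A y = 0 -> Z y = 0.
  by move=> Py; apply: sq_eq0; rewrite /sq (eff_sym hZ) ZZ Py ip0r.
pose K := ortho (mul A); have sM := mul_subspace hA.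
have KP x : K x <-> forall y, res A y = 0 -> ip y x = 0.
  split=> [/(orthoP _ sM) hx y /(mulP _ hA)|hx]; first exact: hx.
  by apply/(orthoP _ sM) => y /(mulP _ hA); exact: hx.
have sK : subspace K by exact: ortho_subspace.
have cK : closed K by exact: ortho_closed.
have KZ x : K x -> K (Z x).
  by move=> _; apply/KP => y /kerZ Zy; rewrite -(eff_sym hZ) Zy ip0l.
have KW x : K x -> K (W x).
  move=> /KP hx; apply/KP => y Py; rewrite -(eff_sym hW); apply: hx.
  by rewrite -ZZ !ZW ZZ Py (eff0 hW).
(* As an equation this set is visibly closed; [SP] gives its parametrization by [(Z h, W h)]. *)
pose S : set (H * H) := [set p | [/\ K p.1, K p.2 & W p.1 = Z p.2]].
have SP a b : S (a, b) <-> exists2 h, K h & a = Z h /\ b = W h.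
  split=> [[/= Ka Kb ab]|[h Kh [-> ->]]]; last by split => /=; [exact: KZ|exact: KW|].
  (* This [h] comes from [Z^2 + W^2 = 1] and [W a = Z b]. *)
  exists (Z a + W b); first by apply: (subspaceD sK); [exact: KZ|exact: KW].
  rewrite (effD hZ) (effD hW) ZZ ZW -ab WW -ZW ab ZZ WW.
  by rewrite addrC subrK addrC subrK.
have Kker b : K b -> Z b = 0 -> b = 0.
  move=> /KP Kb Zb; apply: sq_eq0; apply: Kb; by rewrite -ZZ Zb (eff0 hZ).
exists S; split.
- split.
  + split; last by move=> -[a b] [].
    apply/closed_subspace2P; split.
    * by split => /=; rewrite ?(eff0 hW) ?(eff0 hZ) //; exact: sK.1.
    * move=> c [a b] [a' b'] [/= Ka Kb ab] [/= Ka' Kb' ab']; split => /=.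
      - exact: sK.2.
      - exact: sK.2.
      - by rewrite (eff_lin hW) (eff_lin hZ) ab ab'.
    * apply: closed_of_approx_pair => -[p p'] hp; split => /=.
      - by apply: closed_approx => // e /hp[[x x'] [/= Kx _ _] [xp _]]; exists x.
      - by apply: closed_approx => // e /hp[[x x'] [/= _ Kx _] [_ xp]]; exists x'.
      - apply/eqP; rewrite -subr_eq0; apply/eqP/sq_eq0/eqP.
        rewrite eq_le sq_ge0 andbT; apply/ler_addgt0Pl => e e0; rewrite addr0.
        have [|[x x'] [/= _ _ hx] [xp xp']] := hp (e / 4); first by lra.
        have -> : W p - Z p' = W (p - x) + Z (x' - p').
          by rewrite (effB hW) (effB hZ) hx addrA subrK.
        apply: le_trans (sqD_le _ _) _.
        have := eff_contr hW (p - x); have := eff_contr hZ (x' - p').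
        by rewrite (sqB p) /=; move: xp xp' => /=; lra.
  + apply/seteqP; split=> -[g g'] /=.
      move=> /[dup] -[/= Kg Kg' _] /SP[h Kh [eg eg']]; split => //= -[f f'].
      move=> /SP[k Kk [-> ->]] /=; rewrite eg eg'.
      by rewrite (eff_inner _ _ hW) (eff_inner _ _ hZ) ZW.
    move=> [[/= Kg Kg'] hg]; split => //=.
    (* Split [z] into [w], in the closure of [mul A], and [z - w] in [K]. The vector [W g - Z g'] is
       orthogonal to the first as a member of [K], and to the second by testing [hg] on
       [(Z (z - w), W (z - w))]. *)
    apply: ip_inj => z; have [w [v Mv vw] hw] := projection z sM.
    have Kzw : K (z - w) by apply/orthoP.
    have Kd : K (W g - Z g') by apply: (subspaceB sK); [exact: KW|exact: KZ].
    have d0 : ip (z - w) (W g - Z g') = 0.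
      rewrite ipDr ipNr -(eff_sym hW) -(eff_sym hZ).
      have /hg : S (Z (z - w), W (z - w)) by apply/SP; exists (z - w).
      by rewrite /ip /= => ->; rewrite subrr.
    have w0 : ip w (W g - Z g') = 0.
      apply: (adherent_ortho (D := mul A)); first by exists v.
      by move=> d Md; rewrite ((orthoP _ sM).1 Kd).
    by move: d0 w0; rewrite !ipE; lra.
  + move=> -[f f'] /SP[h Kh [-> ->]] /=; apply: inner_ge0.
      by rewrite !eff_inner // ZW.
    rewrite (eff_sym hW) ipC (_ : ip _ _ = ip (W (Y h)) (Y h)); first exact: eff_ge0.
    by rewrite -YY WY (eff_sym hY).
- apply/seteqP; split=> m /=.
    by move=> [/= _ Km]; rewrite (eff0 hW) => /esym; exact: Kker.
  by move=> ->; split; rewrite /= ?(eff0 hW) ?(eff0 hZ) //; exact: sK.1.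
- apply/seteqP; split=> -[f f'] /=.
    move=> [g [[/= Kf Kg fg] [/= _ Kf' gf']]]; split => //.
    rewrite (nsa_rel hA) /rel /= (effD hP) -(ZZ f') -gf' ZW -fg WW.
    by rewrite addrC subrK.
  move=> [Af [_ Kf']]; rewrite (nsa_rel hA) /rel /= in Af.
  have Kf : K f by rewrite -Af -ZZ; apply/KP => y /kerZ Zy; rewrite -(eff_sym hZ) Zy ip0l.
  pose h := f + f'; have Kh : K h by exact: (subspaceD sK Kf Kf').
  have ef : f = Z (Z h) by rewrite ZZ Af.
  have ef' : f' = W (W h) by rewrite WW Af /h addrC addKr.
  exists (Z (W h)); split; apply/SP.
    by exists (Z h); [exact: KZ|rewrite ZW].
  by exists (W h); [exact: KW|].
Qed.

Section FormOfSqrt.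
Variables (A S : set (H * H)).
Hypothesis (hA : nonneg_selfadjoint setT A) (hS : is_sqrt A S).

Let nS : nonneg_selfadjoint (ortho (mul A)) S. Proof. by case: hS. Qed.

Lemma sqrt_fun x y y' : S (x, y) -> S (x, y') -> y = y'.
Proof.
move=> Sy Sy'; have := nsa_sub nS Sy Sy'; rewrite subrr.
case: hS => _ + _ => /seteqP[+ _] => /(_ (y - y'))/[apply] /eqP.
by rewrite subr_eq0 => /eqP.
Qed.

(** The first representation theorem for the form of [A + I]. Removing from [h - f] its component
    [m] in [mul A] leaves the value at [f] of the operator part, that is [S (S f)]; and [m] is
    orthogonal to the domain of [S]. *)
Lemma sqrt_core h : exists k, S (res A h, k) /\
  forall phi g, S (phi, g) -> ip h phi = ip (res A h) phi + ip k g.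
Proof.
have Af := resP h hA; set f := res A h in Af *.
have sM := mul_subspace hA.
have [m /(adherent_closed (mul_closed hA)) Mm hm] := projection (h - f) sM.
have Ko : ortho (mul A) (h - f - m) by apply/orthoP.
have Afo : A (f, h - f - m).
  by have := nsa_sub hA Af Mm; rewrite subr0.
have : operator_part A (f, h - f - m) by split.
case: hS => _ _ <- [k [Sfk Sko]] /=; exists k; split => // phi g Sphi.
have Kphi : ortho (mul A) phi.
  by move: Sphi; rewrite (nsaE nS) => -[[]].
have mphi : ip m phi = 0 by rewrite ((orthoP _ sM).1 Kphi).
rewrite -(nsa_ip_sym nS Sko Sphi) !ipE mphi.
by rewrite subr0 addrC subrK.
Qed.

(* The graph of [S] over the domain of [A] is dense in the graph of [S], so the
   closed form is the Legendre transform of the form of the resolvent. *)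
Lemma form_of_sqrtP phi c : (exists2 g, S (phi, g) & sq phi + sq g <= c) <->
  forall h, 2 * ip h phi - ip (res A h) h <= c.
Proof.
have hP := res_effect hA; split.
  move=> [g Sg gc] h; have [k [Sk hk]] := sqrt_core h.
  (* With [f = res A h], the left side equals [|phi|^2 + |g|^2 - |f - phi|^2 - |k - g|^2]. *)
  rewrite (ipC h) (hk _ _ Sg) (hk _ _ Sk).
  have := sq_ge0 (res A h - phi); have := sq_ge0 (k - g).
  by move: gc; rewrite /sq !ipE (ipC k g) (ipC (res A h) phi); lra.
move=> hc; have [||u [_ cu hu]] := @maximizing_seq _ _ setT (res A) phi c _ hP.
- by [].
- by move=> h _; exact: hc.
have /choice[k hk] := fun n => sqrt_core (u n).
have Sk n : S (res A (u n), k n) by case: (hk n).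
pose f n := res A (u n).
have uk n psi g : S (psi, g) -> ip (u n) psi = ip (f n) psi + ip (k n) g.
  by case: (hk n) => _; exact.
(* The form of [res A] is the squared graph norm of [S], so the maximizing sequence yields a Cauchy
   sequence in the graph. *)
have norm_diff m n : ip (res A (u m - u n)) (u m - u n) = sq (f m - f n) + sq (k m - k n).
  have Sd := nsa_sub nS (Sk m) (Sk n).
  rewrite (effB hP) ipDr ipNr (ipC (u m)) (ipC (u n)) (uk m _ _ Sd) (uk n _ _ Sd).
  by rewrite /sq !ipE; lra.
have [l fl] : exists l, tends f l.
  apply: tends_complete => e /cu[N hN]; exists N => m n Nm Nn.
  have := hN m n Nm Nn; rewrite norm_diff; have := sq_ge0 (k m - k n); lra.
have [g kg] : exists g, tends k g.
  apply: tends_complete => e /cu[N hN]; exists N => m n Nm Nn.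
  have := hN m n Nm Nn; rewrite norm_diff; have := sq_ge0 (f m - f n); lra.
have Sg : S (l, g) by exact: closed_tends_pair (nsa_closed nS) Sk fl kg.
have phil : phi = l.
  apply: ip_inj => v; apply: (cvg_unique _ (hu v I)) => //.
  have -> : (fun n => ip (res A v) (u n)) = fun n => ip v (f n).
    by apply/funext => n; rewrite (eff_sym hP).
  exact: tends_ipr fl.
exists g; rewrite phil //; apply/ler_addgt0Pl => e e0.
have [|N hN] := fl (e / 2); first by lra.
have [|N' hN'] := kg (e / 2); first by lra.
pose n := maxn N N'; have := hN n (leq_maxl _ _); have := hN' n (leq_maxr _ _).
(* By the same completion of squares, the functional at [u n] is [|l|^2 + |g|^2] less the two
   squared distances, each below [e / 2]. *)
have := hc (u n); rewrite (ipC (u n)) (uk n _ _ (Sk n)) -/(f n).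
rewrite phil (uk n _ _ Sg) /sq !ipE (ipC (f n) l) (ipC (k n) g).
by lra.
Qed.

End FormOfSqrt.

Lemma sqrt_opP A : nonneg_selfadjoint setT A -> is_sqrt A (sqrt_op A).
Proof. by move=> /is_sqrt_exists ex; exact: xgetPex ex. Qed.

Lemma form_val A phi g : nonneg_selfadjoint setT A -> sqrt_op A (phi, g) ->
  form A phi = (sq g)%:C.
Proof.
move=> hA hg; rewrite /form -norm_sq; congr (`|_| ^+ 2).
apply: (sqrt_fun (sqrt_opP hA) _ hg).
have ex : exists y, [set y | sqrt_op A (phi, y)] y by exists g.
exact: (xgetPex (0 : H) ex).
Qed.

(** The order of forms becomes the reverse order of resolvents, both directions by the Legendre
    transform of [form_of_sqrtP]. *)
Lemma lr_leP A B : nonneg_selfadjoint setT A -> nonneg_selfadjoint setT B ->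
  lr_le A B <-> forall h, ip (res B h) h <= ip (res A h) h.
Proof.
move=> hA hB.
have FA := form_of_sqrtP hA (sqrt_opP hA); have FB := form_of_sqrtP hB (sqrt_opP hB).
have hPB := res_effect hB.
split=> [[dAB AB] h|AB].
  (* At [phi = res B h] the supremum is attained at [h] itself, with value [(res B h, h)]. *)
  have [|g Sg gc] := (FB (res B h) (ip (res B h) h)).2.
    move=> k; have := eff_ge0 hPB (h - k).
    rewrite (effB hPB) !ipE (ipC k (res B h)) (eff_sym hPB k h).
    by lra.
  have domB : form_dom B (res B h) by exists g.
  have [g' Sg'] := dAB _ domB.
  have := AB _ domB; rewrite (form_val hA Sg') (form_val hB Sg) lecR => gg'.
  have /FA/(_ h) : exists2 g, sqrt_op A (res B h, g) &
      sq (res B h) + sq g <= ip (res B h) h by exists g' => //; lra.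
  by rewrite (ipC (res B h) h); lra.
have h1 phi g : sqrt_op B (phi, g) -> exists2 g', sqrt_op A (phi, g') & sq g' <= sq g.
  move=> Sg.
  have hphi : forall h, 2 * ip h phi - ip (res B h) h <= sq phi + sq g.
    by apply/FB; exists g.
  have /FA[g' Sg' g'g] : forall h, 2 * ip h phi - ip (res A h) h <= sq phi + sq g.
    by move=> h; have := hphi h; have := AB h; lra.
  by exists g' => //; lra.
split=> [phi [g /h1[g' Sg' _]]|phi [g Sg]]; first by exists g'.
have [g' Sg' g'g] := h1 _ _ Sg.
by rewrite (form_val hA Sg') (form_val hB Sg) lecR.
Qed.

End Forms.

(** * Krein's shorted operator *)

Section Shorted.
Context {R : realType} {H : hilbertType R}.
Implicit Types (x y z h : H) (a : R) (D L : set H) (P Q T : H -> H) (A B : set (H * H)).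

Lemma adherent_subspace D : subspace D -> subspace (adherent D).
Proof.
move=> sD; split; first by exists (fun=> 0); [move=> _; exact: sD.1|exact: tends_cst].
move=> c x y [u Du ux] [v Dv vy]; exists (fun n => c *: u n + v n).
  by move=> n; exact: sD.2.
exact: tendsD (tendsZ _ ux) vy.
Qed.

(** Here [P] projects onto the orthogonal complement of [D]. Its linearity defect lies both in the
    closure of [D] and in that complement, hence vanishes. *)
Lemma ortho_projection D : subspace D -> exists P, effect P /\
  forall x, adherent D (x - P x) /\ forall d, D d -> ip d (P x) = 0.
Proof.
move=> sD; have sA := adherent_subspace sD.
have /choice[P hP] : forall x, exists p, adherent D (x - p) /\ ortho D p.
  move=> x; have [w Dw hw] := projection x sD.
  by exists (x - w); split; [rewrite subKr|exact/orthoP].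
have aP x : adherent D (x - P x) by case: (hP x).
have oP x : ortho D (P x) by case: (hP x).
have dP x d : D d -> ip d (P x) = 0 by move: d; apply/orthoP.
have PP x y : ip (P x) y = ip (P x) (P y).
  have := adherent_ortho (aP y) (dP x).
  by rewrite ipC !ipE; lra.
exists P; split=> [|x]; last by split => //; exact: dP.
split=> [c x y|x y|x|x].
- apply/eqP; rewrite -subr_eq0; apply/eqP/sq_eq0.
  set d := _ - _.
  have ad : adherent D d.
    have -> : d = (c *: (x - P x) + (y - P y)) - (c *: x + y - P (c *: x + y)).
      by rewrite /d scalerBr addrACA -opprD opprB [RHS]addrC addrA subrK.
    by apply: subspaceB => //; apply: sA.2.
  have od : ortho D d.
    apply: (subspaceB (ortho_subspace D)) => //.
    exact: (ortho_subspace D).2.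
  by apply: adherent_ortho ad _; apply/orthoP.
- by rewrite (PP x y) (ipC (P y) x) (PP y x) ipC.
- by rewrite PP sq_ge0.
- by have := sq_ge0 (x - P x); have := PP x x; rewrite /sq !ipE (ipC (P x) x); lra.
Qed.

(* Krein's shorted operator: [sqrt Q] composed on both sides of the orthogonal
   projection onto the preimage of [L] under [sqrt Q]. *)
Lemma shorted_effect Q L : effect Q -> subspace L -> closed L ->
  exists QL, [/\ effect QL, forall x, L (QL x),
    forall x, ip (QL x) x <= ip (Q x) x &
    forall Q', effect Q' -> (forall x, L (Q' x)) ->
      (forall x, ip (Q' x) x <= ip (Q x) x) ->
      forall x, ip (Q' x) x <= ip (QL x) x].
Proof.
move=> hQ sL cL; have [Z [hZ ZZ _]] := effect_sqrt hQ.
(* The orthogonal complement of [D] is the preimage of [L] under [Z], because [(Z m, x) = (m, Z x)]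
   and [L] is closed. *)
pose D := [set Z m | m in ortho L].
have sD : subspace D.
  split; first by exists 0; [exact: (ortho_subspace L).1|exact: eff0].
  move=> c _ _ [m Lm <-] [m' Lm' <-]; exists (c *: m + m').
    exact: (ortho_subspace L).2.
  exact: eff_lin.
have [P [hP aoP]] := ortho_projection sD.
exists (fun x => Z (P (Z x))); split=> [|x|x|Q' hQ' Q'L Q'Q x].
- split=> [c x y|x y|x|x].
  + by rewrite (eff_lin hZ) (eff_lin hP) (eff_lin hZ).
  + by rewrite !(eff_sym hZ, eff_sym hP).
  + by rewrite (eff_sym hZ) eff_ge0.
  + by rewrite (eff_sym hZ); apply: le_trans (eff_le1 hP _) (eff_contr hZ _).
- apply: ortho_ortho => //; apply/orthoP; first exact: ortho_subspace.
  move=> m Lm; rewrite -(eff_sym hZ); apply: (aoP _).2.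
  by exists m.
- by rewrite (eff_sym hZ) -ZZ (eff_sym hZ (Z x)) eff_le1.
- have [ap op] := aoP (Z x); set p := P (Z x) in ap op *.
  (* A competitor [Q'] vanishes on the complement of [L], so its form at [x] is that at [x - m], at
     most [|Z x - Z m|^2]. Choosing [Z m] close to [Z x - p] brings this bound down to [|p|^2]. *)
  have Q'm m : ortho L m -> Q' m = 0.
    move=> /(orthoP _ sL) om; apply: ip_eq0P => y.
    by rewrite (eff_sym hQ') ipC om.
  rewrite (eff_sym hZ); have pp : ip p (Z x) = sq p.
    have := adherent_ortho ap op; rewrite ipC !ipE /sq; lra.
  rewrite pp; apply/ler_addgt0Pl => e e0.
  have [v Dv vp] := ap; have [N /(_ N (leqnn N)) hN] := vp _ e0.
  have [m Lm Zm] := Dv N.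
  have e1 : ip (Q' x) x = ip (Q' (x - m)) (x - m).
    rewrite (effB hQ') (Q'm _ Lm) subr0 !ipE (eff_sym hQ' x m) (Q'm _ Lm).
    by rewrite ip0r oppr0 addr0.
  have e2 : ip (Q (x - m)) (x - m) = sq (Z x - v N).
    by rewrite -Zm -(effB hZ) -ZZ (eff_sym hZ (Z _)).
  have ar : adherent D (Z x - p - v N).
    apply: (subspaceB (adherent_subspace sD)) => //.
    by exists (fun=> v N); [move=> _; exact: Dv|exact: tends_cst].
  rewrite e1; apply: le_trans (Q'Q _) _; rewrite e2.
  have -> : Z x - v N = p + (Z x - p - v N) by rewrite addrA (addrC p) subrK.
  move: hN (adherent_ortho ar op); rewrite sqB; move: (Z x - p - v N) => r hr o.
  by rewrite /sq !ipE (ipC r p) o; move: hr; rewrite /sq; lra.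
Qed.

Lemma effect_ext P Q : effect P -> effect Q ->
  (forall x, ip (P x) x = ip (Q x) x) -> P = Q.
Proof.
move=> hP hQ PQ; apply/funext => x; apply: ip_inj => y.
have := PQ (x + y); rewrite (effD hP) (effD hQ) !ipE.
rewrite (eff_sym hP y x) (eff_sym hQ y x) (ipC y (P x)) (ipC y (Q x)).
by have := PQ x; have := PQ y; lra.
Qed.

(** Carries the maximality defining [shorted] over to effects, where [1 - res A] takes the place of
    [A] and the order is that of the forms. *)
Lemma shortedP A L : nonneg_selfadjoint setT A -> closed_subspace L ->
  exists Q, [/\ effect Q, shorted A L = rel (fun x => x - Q x),
    forall x, L (Q x), forall x, ip (Q x) x <= ip (x - res A x) x &
    forall Q', effect Q' -> (forall x, L (Q' x)) ->
      (forall x, ip (Q' x) x <= ip (x - res A x) x) ->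
      forall x, ip (Q' x) x <= ip (Q x) x].
Proof.
move=> hA /closed_subspaceP[sL cL]; have hP := res_effect hA.
have [Q [hQ QL QA Qmax]] := shorted_effect (eff_compl hP) sL cL.
exists Q; split => //; set B := rel _.
have hB : nonneg_selfadjoint setT B by exact: rel_nsa (eff_compl hQ).
have rB : res B = fun x => x - Q x by exact: res_rel (eff_compl hQ).
have XB : shorted_set A L B.
  split => //.
    apply/lr_leP => // x; rewrite rB !ipE; have := QA x; rewrite !ipE; lra.
  by move=> f' [f]; rewrite /B /rel /= => /eqP; rewrite subr_eq => /eqP/addrI ->.
have BleX C : shorted_set A L C -> forall x, ip (res B x) x <= ip (res C x) x.
  move=> [hC CA CL] x; rewrite rB.
  have hQC := eff_compl (res_effect hC).
  have := Qmax _ hQC _ _ x; rewrite /= !ipE => h.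
  suff : ip x x - ip (res C x) x <= ip (Q x) x by lra.
  apply: h => [y|y]; first by apply: CL; exists (res C y); exact: resP.
  by move/(lr_leP hC hA) : CA => /(_ y); rewrite !ipE; lra.
have eqB C : shorted_set A L C -> lr_le B C -> C = B.
  move=> XC; have [hC _ _] := XC; move=> /(lr_leP hB hC) CB.
  rewrite (nsa_rel hC) (nsa_rel hB); congr rel.
  apply: effect_ext; [exact: res_effect|exact: res_effect|move=> x].
  by apply/eqP; rewrite eq_le CB BleX.
have ex : exists B, maximal_lr (shorted_set A L) B by exists B; split.
rewrite /shorted; have [XS Smax] := xgetPex set0 ex.
(* [B] is the greatest element of [shorted_set A L], so it lies above whichever maximal element
   [xget] picks, and maximality identifies the two. *)
apply/esym/Smax => //; apply/lr_leP => //; first by case: XS.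
by move=> x; exact: BleX.
Qed.

Lemma tends_ge_ip (u : nat -> H) l y a N : tends u l ->
  (forall n, (N <= n)%N -> a <= ip (u n) y) -> a <= ip l y.
Proof.
move=> ul h; have ul' : tends (fun n => u (n + N)%N) l.
  by move=> e /ul[N' hN']; exists N' => n Nn; apply: hN'; exact: leq_trans (leq_addr _ _).
by apply: (tends_le_ip (y := y) ul') => n; apply: h; exact: leq_addl.
Qed.

End Shorted.

(** * Monotonicity and convergence of the shorted relations *)

Theorem proposition3p2 (R : realType) (H : hilbertType R)
    (A : nat -> set (H * H)) (Ainf : set (H * H)) (L : set H)
    (hA : forall n, nonneg_selfadjoint setT (A n))
    (hAinf : nonneg_selfadjoint setT Ainf)
    (hL : closed_subspace L)
    (A_nonincr : nonincreasing_lr A)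
    (A_cvg : strong_resolvent_cvg A Ainf) :
  nonincreasing_lr (fun n => shorted (A n) L) /\
  strong_resolvent_cvg (fun n => shorted (A n) L) (shorted Ainf L).
Proof.
have /choice[Q hQ] := fun n => shortedP (hA n) hL.
have [Qinf [hQinf sinf QinfL QinfA Qinfmax]] := shortedP hAinf hL.
have eQ n : effect (Q n) by case: (hQ n).
have sA n : shorted (A n) L = rel (fun x => x - Q n x) by case: (hQ n).
have QL n x : L (Q n x) by case: (hQ n).
have QA n x : ip (Q n x) x <= ip (x - res (A n) x) x by case: (hQ n).
have Qmax n Q' : effect Q' -> (forall x, L (Q' x)) ->
    (forall x, ip (Q' x) x <= ip (x - res (A n) x) x) ->
    forall x, ip (Q' x) x <= ip (Q n x) x.
  by case: (hQ n) => _ _ _ _; exact.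
have resA m n : (m <= n)%N -> forall x, ip (res (A m) x) x <= ip (res (A n) x) x.
  by move=> /A_nonincr/lr_leP; apply.
have resAcvg x : tends (fun n => res (A n) x) (res Ainf x) by apply/tendsP; exact: A_cvg.
have resAinf n x : ip (res (A n) x) x <= ip (res Ainf x) x.
  by apply: (tends_ge_ip (resAcvg x) (N := n)) => m nm; exact: resA.
(* [Q n] competes in the maximum defining [Q m], since [1 - res (A n) <= 1 - res (A m)]. *)
have Qmono m n x : (m <= n)%N -> ip (Q n x) x <= ip (Q m x) x.
  move=> mn; apply: Qmax => // {}x; apply: le_trans (QA n x) _.
  by rewrite !ipE; have := resA _ _ mn x; lra.
split.
  move=> m n mn; rewrite !sA; apply/lr_leP => [||x]; try exact: rel_nsa (eff_compl _).
  rewrite !res_rel; try exact: eff_compl.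
  by rewrite !ipE; have := Qmono _ _ x mn; lra.
have [S [hS QS]] := decreasing_effect_cvg eQ Qmono.
have Sle n x : ip (S x) x <= ip (Q n x) x.
  rewrite -lerN2 -(ipNl (S x)); apply: (tends_ge_ip (tendsN (QS x)) (N := n)) => m nm.
  by rewrite ipNl lerN2; exact: Qmono.
have cL : closed L by case: hL.
have Sinf : Qinf = S.
  apply: effect_ext => // x; apply/eqP; rewrite eq_le; apply/andP; split.
    (* [Qinf] competes in the maximum defining each [Q n], hence stays below the limit [S]. *)
    apply: (tends_le_ip (QS x)) => n; apply: Qmax => // y.
    by apply: le_trans (QinfA y) _; rewrite !ipE; have := resAinf n y; lra.
  (* Conversely [S] competes for [Qinf]: its values lie in the closed [L], and
     [S <= Q n <= 1 - res (A n)] passes to the limit. *)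
  apply: Qinfmax => // {}x; first exact: closed_tends cL (QL^~ x) (QS x).
  rewrite ipDl ipNl; suff : ip (res Ainf x) x <= ip x x - ip (S x) x by lra.
  rewrite -lerN2 -(ipNl (res Ainf x)).
  apply: (tends_le_ip (tendsN (resAcvg x))) => n; rewrite ipNl lerN2.
  by have := Sle n x; have := QA n x; rewrite !ipE; lra.
move=> h; rewrite sinf.
have -> : (fun n => value (resolvent (shorted (A n) L)) h) = fun n => h - Q n h.
  by apply/funext => n; rewrite sA -/(res _) res_rel //; exact: eff_compl.
rewrite -/(res _) res_rel; last exact: eff_compl.
by apply/tendsP; apply: tendsD; [exact: tends_cst|rewrite Sinf; exact: tendsN].
Qed.
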